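(* Let $n\in 8\mathbb{N}$ be a positive integer. The number of integral oriented circulant graphs $\mathrm{IOCG}_n(\mathbf{D},\sigma)$ of order $n$ having multiple state transfer is $$2\times 2\times 3^{\tau\left(\frac n4\right)-2\tau\left(\frac{n}{2^{\vartheta_2(n)}}\right)},$$ where $\tau(x)$ denotes the number of positive divisors of $x$.
   Context: Let $n$ be a positive integer with $n\equiv 0\pmod 4$. For a positive divisor $d$ of $n/4$ and $r\in\{1,3\}$ let $G_n^r(d)=\{dk : k\equiv r \pmod 4,\ \gcd(dk,n)=d\}$, regarded as a subset of $\mathbb{Z}_n$. Given a nonempty set $\mathbf{D}$ of positive divisors of $n/4$ and a map $\sigma:\mathbf{D}\to\{1,-1\}$, put $S_n(d)=G_n^1(d)$ if $\sigma(d)=1$, $S_n(d)=G_n^3(d)$ if $\sigma(d)=-1$, and $\mathcal{C}=\bigcup_{d\in\mathbf{D}}S_n(d)$. Then $\mathrm{IOCG}_n(\mathbf{D},\sigma)$ is the oriented graph with vertex set $\mathbb{Z}_n$ and arc set $\{(a,b): b-a\in\mathcal{C}\}$; the (nonempty) integral oriented circulant graphs, i.e. those whose Hermitian adjacency matrix has only integer eigenvalues, are exactly these graphs. Graphs are counted as pairs $(\mathbf{D},\sigma)$ (equivalently, by their symbol $\mathcal{C}$), not up to isomorphism. The Hermitian adjacency matrix $H=(h_{uv})$ of an oriented graph has $h_{uv}=\mathrm{i}$ if $(u,v)$ is an arc, $h_{uv}=-\mathrm{i}$ if $(v,u)$ is an arc, and $h_{uv}=0$ otherwise, where $\mathrm{i}=\sqrt{-1}$.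 Let $U(t)=\exp(\mathrm{i}tH)$ and let $\mathbf{e}_u$ be the standard basis vector indexed by the vertex $u$. The graph has perfect state transfer from $u$ to $v$ if there are $t\in\mathbb{R}$ and a complex number $\gamma$ with $|\gamma|=1$ such that $U(t)\mathbf{e}_u=\gamma\mathbf{e}_v$. The graph has multiple state transfer if there is a set $S$ of at least three vertices such that perfect state transfer occurs between each pair of distinct vertices in $S$ (the time may depend on the pair). For a positive integer $x$, $\vartheta_2(x)$ is the exponent of the largest power of $2$ dividing $x$. *)

(* Defs.v *)
From HB Require Import structures.
From mathcomp Require Import all_boot all_order all_algebra.
From mathcomp Require Import complex.
From mathcomp Require Import boolp classical_sets reals topology normedtype sequences.
Set Implicit Arguments.
Unset Strict Implicit.
Unset Printing Implicit Defensive.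
Import Order.TTheory GRing.Theory Num.Theory.
Import numFieldNormedType.Exports.
Local Open Scope complex_scope.
Local Open Scope ring_scope.

(* [limn] is a total operator; it is the true limit here because the
   exponential series converges over [K = R[i]]. Over an arbitrary
   [numFieldType] the value is meaningful only when the series converges. *)
Definition expmx (K : numFieldType) (N : nat) (A : 'M[K]_N) : 'M[K]_N :=
  limn (series (fun k => (k`!%:R)^-1 *: A ^+ k)).

Section StateTransfer.
Variables (R : realType) (N : nat) (e : rel 'I_N).

Definition hermitian_adjacency : 'M[R[i]]_N :=
  \matrix_(u, v) if e u v then 'i%C else if e v u then - 'i%C else 0.

Definition transition_matrix (t : R) : 'M[R[i]]_N :=
  expmx (('i%C * t%:C) *: hermitian_adjacency).

Definition std_basis (u : 'I_N) : 'cV[R[i]]_N := delta_mx u 0.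

Definition perfect_state_transfer (u v : 'I_N) : Prop :=
  exists (t : R) (gamma : R[i]), `|gamma| = 1 /\
    transition_matrix t *m std_basis u = gamma *: std_basis v.

Definition multiple_state_transfer : Prop :=
  exists S : {set 'I_N}, (3 <= #|S|)%N /\
    forall u v, u \in S -> v \in S -> u != v -> perfect_state_transfer u v.

End StateTransfer.

(* Below, ['Z_n] is the ring of integers modulo [n] only when [1 < n]. *)

Definition Gset (n : nat) (r : int) (d : nat) : {set 'Z_n} :=
  [set x : 'Z_n | `[< exists k : int,
     [/\ (k = r %[mod 4])%Z, gcdz (d%:Z * k) n%:Z = d%:Z
       & x = (d%:Z * k)%:~R] >]]%SET.

Definition quarter_divisor (n : nat) : Type := seq_sub (divisors (n %/ 4)).
HB.instance Definition _ n := Finite.on (quarter_divisor n).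

(* The pairs (D, sigma); [true] encodes the sign 1 and [false] the sign -1.
   [D] may be empty here: nonemptiness is imposed where graphs are counted. *)
Definition iocg_data (n : nat) : Type :=
  {D : {set quarter_divisor n} & {ffun {d | d \in D} -> bool}}.
HB.instance Definition _ n := Finite.on (iocg_data n).

Section IOCG.
Variables (n : nat) (D : {set quarter_divisor n}).
Variable sigma : {ffun {d | d \in D} -> bool}.

Definition Sset (d : {d | d \in D}) : {set 'Z_n} :=
  if sigma d then Gset n 1 (val (val d)) else Gset n 3 (val (val d)).

Definition iocg_symbol : {set 'Z_n} := (\bigcup_(d : {d | d \in D}) Sset d)%SET.

Definition IOCG : rel 'Z_n := fun a b => b - a \in iocg_symbol.

End IOCG.

Definition has_MST (R : realType) (n : nat) (G : iocg_data n) : Prop :=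
  multiple_state_transfer R (IOCG (tagged G)).

(* For n = 2 ^ a * m with m odd and 3 <= a, tau (n / 4) = (a - 1) * tau m, so
   tau (n / 4) - 2 * tau m does not truncate on [nat]. *)
Definition tau (m : nat) : nat := size (divisors m).

Definition theta2 (m : nat) : nat := logn 2 m.

(* Main.v *)
Require Import Defs.
From HB Require Import structures.
From mathcomp Require Import all_boot all_order all_algebra complex.
From mathcomp Require Import boolp classical_sets reals topology normedtype.
From mathcomp Require Import sequences trigo.
From mathcomp Require Import zify ring lra.
From mathcomp Require Import finset.
Set Implicit Arguments.
Unset Strict Implicit.
Unset Printing Implicit Defensive.
Import Order.TTheory GRing.Theory Num.Theory.
Import numFieldNormedType.Exports.

(** Translations of Z/n commute with the Hermitian adjacency matrix [H] of a
    circulant graph, so the Fourier matrix diagonalizes [H] and perfect state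
    transfer can be read off the eigenvalues.

    Put n = 4Q, let chi be the nonprincipal character modulo 4 and encode
    (D, sigma) as a function s from the divisors of Q to {0, 1, -1}.  The signed
    indicator of the symbol is x |-> s(g) chi(x/g) with g = gcd(x, n).  Its
    Fourier transform involves Ramanujan sums as long as one works with s; but
    writing s as a Dirichlet convolution s = t * chi turns it into the sum of
    t(e) chi(x/e) over the common divisors e of x and Q, where no coprimality
    condition is left ([symbol_functionE]).  Each summand is then a geometric
    sum, and the j-th eigenvalue comes out as 2 M(j), where
      M(j) = sum of t(e) L chi(j/L) over e | Q such that L = Q/e divides j
    ([eigenvalue_sum]; M is [spectrum] below).

    Perfect state transfer from u to v therefore means that some unimodular z
    satisfies z^M(j) = w^(j(v-u)) for all j, w being a primitive n-th root of
    unity ([transfer_phase]).  As M(kj) = chi(k) M(j) for k prime to n, a unit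
    k = 1 mod 4 with (k-1)/4 prime to n forces v - u to be a multiple of Q, so
    that three vertices give an odd multiple: multiple state transfer amounts
    to the existence of z with z^M(j) = i^j for all j.

    In M(j) only the e with v_2(Q/e) = v_2(j) contribute, and on each of these
    2-adic levels M determines t, hence s, through triangular systems.  The
    upshot is [level_coefficient]: if all M(j) of level k lie in a subgroup A
    of the integers, then so do 2^k m s(d), where m is the odd part of Q.  It is
    used twice.  With A the exponents k such that z^(4k) = 1 it shows that
    z^m is a fourth root of unity, whence a sign eps with M(j) = eps j mod 4
    for all j ([phase_congruence]).  With A = 4Z it shows that this congruence
    determines s(d) modulo 4 at level 0 and modulo 2 at level 1: there s has
    to vanish except at d = Q and d = Q/2, where it is a sign
    ([rigid_of_spectrum], [spectrum_rigid]).  At the levels k >= 2 all terms of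
    M are divisible by 4 and s is free.

    The count is thus 2 * 2 * 3^f, where f is the number of d | Q with
    4 | Q/d; the other d correspond to the divisors of 2m, of which there are
    twice as many as divisors of m. *)

(** * Exponentials of diagonalized matrices *)
Section DistanceCriterion.
Local Open Scope classical_set_scope.
Local Open Scope ring_scope.
(** Stated over an arbitrary normed field, so that it can be specialized to
    [R[i]]. *)
Lemma numField_cvg_dist (K : numFieldType) (u : nat -> K) (l : K) :
  (forall e, 0 < e -> \forall k \near \oo, `|l - u k| < e) -> u @ \oo --> l.
Proof. by move=> H; apply/cvgrPdist_lt. Qed.
End DistanceCriterion.

Section Cis.
Local Open Scope complex_scope.
Local Open Scope classical_set_scope.
Local Open Scope ring_scope.
Variable R : realType.
Implicit Types x y t : R.

Definition cis x : R[i] := cos x +i* sin x.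

Lemma cis0 : cis 0 = 1.
Proof. by rewrite /cis cos0 sin0. Qed.

Lemma cisD x y : cis (x + y) = cis x * cis y.
Proof. by rewrite /cis cosD sinD; simpc; rewrite (addrC (cos x * sin y)). Qed.

Lemma cisMn x k : cis (x *+ k) = cis x ^+ k.
Proof. by elim: k => [|k IH]; rewrite ?mulr0n ?cis0 ?mulrS ?exprS // cisD IH.
Qed.

Lemma norm_cis x : `|cis x| = 1.
Proof. by rewrite normc_def /= cos2Dsin2 sqrtr1. Qed.

Lemma cis_neq0 x : cis x != 0.
Proof. by rewrite -normr_gt0 norm_cis ltr01. Qed.

Lemma cisN x : cis (- x) = (cis x)^-1.
Proof.
by apply: (mulfI (cis_neq0 x)); rewrite mulfV ?cis_neq0 // -cisD subrr cis0.
Qed.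

Lemma cisMz x (k : int) : cis (x *~ k) = cis x ^ k.
Proof.
by case: k => k; rewrite ?NegzE ?mulrNz ?cisN -pmulrn cisMn // exprnN.
Qed.

Lemma cis_half_pi : cis (pi / 2) = 'i.
Proof. by rewrite /cis cos_pihalf sin_pihalf. Qed.

(** The norm of [a +i* b] is at most [`|a| + `|b|]. *)
Lemma cvg_complex (u v : R^nat) a b :
  u @ \oo --> a -> v @ \oo --> b ->
  (fun k => u k +i* v k) @ \oo --> (a +i* b : (R[i] : numFieldType)).
Proof.
move=> ua vb; apply: numField_cvg_dist => /= e;
  rewrite ltcE /= => /andP[/eqP e0 e1].
case: e e0 e1 => e e' /= -> e_gt0.
have he : 0 < e / 2 by rewrite divr_gt0.
move/cvgrPdist_lt: ua => /(_ _ he) ua; move/cvgrPdist_lt: vb => /(_ _ he) vb.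
near=> k.
have hu : `|a - u k| < e / 2 by near: k.
have hv : `|b - v k| < e / 2 by near: k.
have -> : a +i* b - (u k +i* v k) = (a - u k)%:C + 'i * (b - v k)%:C.
  by simpc.
apply: le_lt_trans (ler_normD _ _) _; rewrite normrM.
have nC (r : R) : `|r%:C| = `|r|%:C :> R[i].
  by rewrite normc_def /= expr0n addr0 sqrtr_sqr.
have -> : `|'i| = 1 :> R[i] by rewrite normc_def /= expr0n expr1n add0r sqrtr1.
rewrite mul1r !nC -rmorphD ltcR.
by rewrite [ltRHS](splitr e) ltrD.
Unshelve. all: by end_near. Qed.

(** Even powers of i feed the cosine series, odd powers the sine series. *)
Lemma exp_term x k :
  (k`!%:R)^-1 * ('i * x%:C) ^+ k = cos_coeff x k +i* sin_coeff x k :> R[i].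
Proof.
rewrite /cos_coeff /sin_coeff /= exprMn -rmorphXn /=.
rewrite -(rmorph_nat (real_complex R)) -fmorphV.
have -> : 'i ^+ k = ((~~ odd k)%:R * (-1) ^+ k./2) +i*
                    ((odd k)%:R * (-1) ^+ k.-1./2) :> R[i].
  have ev h : 'i ^+ h.*2 = ((-1) ^+ h)%:C :> R[i].
    by rewrite -mul2n exprM sqr_i rmorphXn rmorphN1.
  rewrite -{1}(odd_double_half k) exprD ev; case: (boolP (odd k)) => ok /=.
    rewrite expr1; have -> : k.-1./2 = k./2.
      by rewrite -{1}(odd_double_half k) ok add1n /= doubleK.
    by simpc.
  by rewrite expr0; simpc.
by simpc; congr (_ +i* _); rewrite mulrC.
Qed.

Lemma cvg_exp_series x :
  series (fun k => (k`!%:R)^-1 * ('i * x%:C) ^+ k) @ \oo --> (cis x : (R[i] :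
    numFieldType)).
Proof.
have -> : series (fun k => (k`!%:R)^-1 * ('i * x%:C) ^+ k) =
    (fun k => series (cos_coeff x) k +i* series (sin_coeff x) k).
  apply/funext; elim=> [|k IH]; first by rewrite /series /= !big_geq.
  by rewrite !seriesSr IH exp_term; simpc.
apply: cvg_complex.
  by rewrite unlock; exact: is_cvg_series_cos_coeff.
by rewrite unlock; exact: is_cvg_series_sin_coeff.
Qed.

End Cis.

Section MatrixExp.
Local Open Scope complex_scope.
Local Open Scope classical_set_scope.
Local Open Scope ring_scope.

Lemma cvg_mx_entrywise (K : numFieldType) m n (u : nat -> 'M[K]_(m, n)) (M :
  'M[K]_(m, n)) :
  (forall i j, (fun k => u k i j) @ \oo --> M i j) -> u @ \oo --> M.
Proof.
move=> H; apply/cvg_ballP => e e0.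
suff : \forall k \near \oo, forall i j, ball (M i j) e (u k i j).
  by apply: filterS => k Hk; split.
apply: filter_forall => i; apply: filter_forall => j.
exact: (cvg_ball (H i j)).
Qed.

Lemma lim_mx (K : numFieldType) N (u : nat -> 'M[K]_N) (M : 'M[K]_N) :
  (forall i j, (fun k => u k i j) @ \oo --> M i j) -> limn u = M.
Proof. by move=> H; apply: cvg_lim; [exact: norm_hausdorff | exact:
  cvg_mx_entrywise]. Qed.

Lemma cvg_sum_scaled (K : numFieldType) (I : finType) (a b : I -> K)
    (u : I -> nat -> K) (l : I -> K) :
  (forall i, u i @ \oo --> l i) ->
  (fun k => \sum_i a i * u i k * b i) @ \oo --> \sum_i a i * l i * b i.
Proof.
move=> H; apply: cvg_big => [|i _]; first exact: add_continuous.
apply: cvgM; last exact: cvg_cst.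
by apply: cvgM; [exact: cvg_cst | exact: H].
Qed.

(** Conjugating by [F] turns every partial sum into finite linear combinations
    of scalar partial sums, so the entries converge separately. *)
Lemma expmx_diagonalized (R : realType) N (F G A : 'M[R[i]]_N) (x : 'I_N -> R) :
  G *m F = 1%:M -> F *m A = diag_mx (\row_j ('i * (x j)%:C)) *m F ->
  expmx A = G *m diag_mx (\row_j cis (x j)) *m F.
Proof.
move=> GF FA; have FG := mulmx1C GF.
have AE : A = G *m diag_mx (\row_j ('i * (x j)%:C)) *m F.
  by rewrite -mulmxA -FA mulmxA GF mul1mx.
have powE k : A ^+ k = G *m diag_mx (\row_j ('i * (x j)%:C) ^+ k) *m F.
  elim: k => [|k IH].
    rewrite expr0 -[LHS]GF; congr (_ *m _); rewrite -[LHS]mulmx1;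
      congr (_ *m _).
    by apply/matrixP => i j; rewrite !mxE expr0.
  rewrite exprSr IH -mulmxE AE !mulmxA -(mulmxA _ F G) FG mulmx1.
  rewrite -(mulmxA G); congr (_ *m _ *m _).
  by rewrite mulmx_diag; congr diag_mx; apply/rowP => j; rewrite !mxE exprSr.
apply: lim_mx => p q.
have entry (y : 'I_N -> R[i]) :
    (G *m diag_mx (\row_j y j) *m F) p q = \sum_j G p j * y j * F j q.
  rewrite mxE; apply: eq_bigr => j _; congr (_ * _).
  by rewrite mul_mx_diag !mxE.
rewrite entry.
have -> : (fun k => series (fun k0 => (k0`!%:R)^-1 *: A ^+ k0) k p q) =
    (fun k => \sum_j G p j *
       series (fun k0 => (k0`!%:R)^-1 * ('i * (x j)%:C) ^+ k0) k * F j q).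
  have term l : ((l`!%:R)^-1 *: A ^+ l) p q =
      \sum_j (l`!%:R)^-1 * (G p j * ('i * (x j)%:C) ^+ l * F j q).
    by rewrite mxE powE entry mulr_sumr.
  apply/funext => k; rewrite /series /= summxE (eq_bigr _ (fun l _ => term l)).
  rewrite exchange_big; apply: eq_bigr => j _.
  rewrite mulr_sumr mulr_suml; apply: eq_bigr => l _.
  by rewrite !mulrA (mulrC (G p j)).
by apply: cvg_sum_scaled => j; exact: cvg_exp_series.
Qed.

End MatrixExp.

(** * Convolution with the character modulo 4 *)
Section Arith.
Local Open Scope ring_scope.

Definition chi4 (k : nat) : int :=
  if (k %% 4 == 1)%N then 1 else if (k %% 4 == 3)%N then -1 else 0.

Lemma chi4_modn k : chi4 (k %% 4)%N = chi4 k.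
Proof. by rewrite /chi4 modn_mod. Qed.

Lemma chi4M a b : chi4 (a * b)%N = chi4 a * chi4 b.
Proof.
rewrite -(chi4_modn (a * b)%N) -modnMm -(chi4_modn a) -(chi4_modn b) chi4_modn.
have := ltn_pmod a (isT : (0 < 4)%N); have := ltn_pmod b (isT : (0 < 4)%N).
by case: (a %% 4)%N => [|[|[|[|?]]]] //; case: (b %% 4)%N => [|[|[|[|?]]]].
Qed.

Lemma chi4_even k : ~~ odd k -> chi4 k = 0.
Proof. by rewrite /chi4 => ek; case: eqP => ?; last case: eqP => ?; lia. Qed.

Lemma chi4_mod4 k : odd k -> (4 %| chi4 k - k%:Z)%Z.
Proof.
by rewrite /chi4 => ok; case: eqP => ?; last case: eqP => ?; lia.
Qed.

Lemma logn2_odd k : (0 < k)%N -> (logn 2 k == 0%N) = odd k.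
Proof.
by move=> k0; rewrite -leqn0 leqNgt logn_gt0 mem_primes /= k0 dvdn2 negbK.
Qed.

Lemma logn2M_odd a b : (0 < a)%N -> odd b -> logn 2 (a * b)%N = logn 2 a.
Proof.
move=> a0 ob; have b0 : (0 < b)%N by case: b ob.
by rewrite lognM //; move: ob; rewrite -logn2_odd // => /eqP->; rewrite addn0.
Qed.

Variable Q : nat.
Hypothesis Q0 : (0 < Q)%N.

(** The Dirichlet convolution [s = t * chi4], on the divisors of [Q] only. *)
Definition chi_convolves (s t : nat -> int) : Prop := forall d, (d %| Q)%N ->
  s d = \sum_(e : 'I_Q.+1 | (e %| d)%N) t e * chi4 (d %/ e)%N.

(** Half of the [j]-th eigenvalue, see [eigenvalue_sum]. *)
Definition spectrum (t : nat -> int) (j : nat) : int :=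
  \sum_(e : 'I_Q.+1 | (e %| Q)%N && (Q %/ e %| j)%N)
    t e * (Q %/ e)%N%:Z * chi4 (j %/ (Q %/ e))%N.

Lemma divisor_gt0 d : (d %| Q)%N -> (0 < d)%N.
Proof. exact: dvdn_gt0. Qed.

Lemma divisor_lt d : (d %| Q)%N -> (d < Q.+1)%N.
Proof. by move=> dQ; rewrite ltnS dvdn_leq. Qed.

Lemma codivisor d e : (d %| Q)%N -> (e %| d)%N ->
  (Q %/ e)%N = (Q %/ d * (d %/ e))%N.
Proof.
move=> dQ ed; have e0 : (0 < e)%N by apply: dvdn_gt0 ed; exact: divisor_gt0.
by rewrite -{1}(divnK dQ) muln_divA.
Qed.

Lemma codivisor_gt0 e : (e %| Q)%N -> (0 < Q %/ e)%N.
Proof. by move=> eQ; rewrite divn_gt0 ?divisor_gt0 // dvdn_leq. Qed.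

Lemma codivisorK e : (e %| Q)%N -> (Q %/ (Q %/ e))%N = e.
Proof.
move=> eQ; have e0 := divisor_gt0 eQ.
have L0 := codivisor_gt0 eQ; apply/eqP.
by rewrite -(eqn_pmul2r L0) divnK ?dvdn_div // mulnC divnK.
Qed.

Lemma convolution_peel (t : nat -> int) d : (d %| Q)%N ->
  \sum_(e : 'I_Q.+1 | (e %| d)%N) t e * chi4 (d %/ e)%N =
  t d + \sum_(e : 'I_Q.+1 | (e %| d)%N && (e < d)%N) t e * chi4 (d %/ e)%N.
Proof.
move=> dQ; have d0 := divisor_gt0 dQ.
rewrite (bigD1 (Ordinal (divisor_lt dQ))) //= divnn d0 mulr1; congr (_ + _).
apply: eq_bigl => e; case ed : (e %| d)%N => //=.
by rewrite ltn_neqAle (dvdn_leq d0 ed) andbT.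
Qed.

(** Since [chi4 1 = 1], the relation can be solved for [t d] once [t] is known
    on the proper divisors of [d]. *)
Lemma chi_convolves_exists s : exists t, chi_convolves s t.
Proof.
have H B : exists t : nat -> int, forall d, (d %| Q)%N -> (d <= B)%N ->
    s d = \sum_(e : 'I_Q.+1 | (e %| d)%N) t e * chi4 (d %/ e)%N.
  elim: B => [|B [t IH]].
    by exists (fun=> 0) => d dQ; rewrite leqNgt divisor_gt0.
  pose v := s B.+1 - \sum_(e : 'I_Q.+1 | (e %| B.+1)%N && (e < B.+1)%N)
                       t e * chi4 (B.+1 %/ e)%N.
  (* Extend t from the divisors up to B to B + 1. *)
  exists (fun d => if d == B.+1 then v else t d) => d dQ.
  rewrite leq_eqVlt ltnS => /orP[/eqP dB|dB].
    rewrite [RHS](convolution_peel (fun d => if d == B.+1 then v else t d)) //.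
    rewrite dB eqxx (eq_bigr (fun e : 'I_Q.+1 => t e * chi4 (B.+1 %/ e)%N)).
      by rewrite subrK.
    by move=> e /andP[_ /ltn_eqF->].
  rewrite IH //; apply: eq_bigr => e ed.
  rewrite ifN // neq_ltn ltnS (leq_trans _ dB) // dvdn_leq //.
  exact: divisor_gt0.
by have [t Ht] := H Q; exists t => d dQ; apply: Ht => //; exact: dvdn_leq.
Qed.

Section Level.
Variables (s t : nat -> int) (A : zmodClosed int) (k : nat).
Hypothesis st : chi_convolves s t.
Hypothesis AM : forall j, (0 < j)%N -> logn 2 j = k -> spectrum t j \in A.

Lemma mulr_in_subgroup x y : x \in A -> x * y \in A.
Proof. by move=> xA; rewrite -[y]intz mulrzr; exact: rpredMz. Qed.

(** With [L = Q %/ e], the value of the spectrum at [L] is [t e * L] plus terms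
    indexed by proper divisors [L'] of [L]; the character kills those with
    [L %/ L'] even, and the others are on the same 2-adic level. *)
Lemma level_transform e : (e %| Q)%N -> logn 2 (Q %/ e)%N = k ->
  t e * (Q %/ e)%N%:Z \in A.
Proof.
have [B] := ubnP (Q %/ e)%N; elim: B e => // B IH e; rewrite ltnS => leB eQ kL.
have L0 : (0 < Q %/ e)%N by exact: codivisor_gt0.
have := AM L0 kL; rewrite /spectrum.
rewrite (bigD1 (Ordinal (divisor_lt eQ))) /= ?eQ ?dvdnn // divnn L0 mulr1.
rewrite rpredDr //; apply: rpred_sum => e' /andP[/andP[e'Q L'L] ne].
have L'0 : (0 < Q %/ e')%N by exact: codivisor_gt0.
have [oq|eq] := boolP (odd (Q %/ e %/ (Q %/ e'))%N); last first.
  by rewrite chi4_even // mulr0 rpred0.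
apply: mulr_in_subgroup; apply: IH => //; last first.
  by rewrite -kL -(divnK L'L) mulnC logn2M_odd.
apply: leq_trans leB; rewrite ltn_neqAle dvdn_leq // andbT.
by apply: contraNneq ne => LL; apply/eqP/val_inj;
  rewrite /= -(codivisorK e'Q) LL codivisorK.
Qed.

(** The convolution expresses [s d] through the [t e] of the level of [d], since
    the character vanishes when [d %/ e] is even.  The common multiple [B] of
    the [Q %/ e] on that level makes up for the factors in [level_transform]. *)
Lemma level_coefficient d B : (d %| Q)%N -> logn 2 (Q %/ d)%N = k ->
  (forall L, (L %| Q)%N -> logn 2 L = k -> (L %| B)%N) -> s d * B%:Z \in A.
Proof.
move=> dQ kd hB; rewrite st // mulr_suml; apply: rpred_sum => e ed.
have eQ := dvdn_trans ed dQ.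
have [od|?] := boolP (odd (d %/ e)); last by rewrite chi4_even // mulr0 mul0r
  rpred0.
have ke : logn 2 (Q %/ e)%N = k.
  by rewrite (codivisor dQ ed) logn2M_odd // codivisor_gt0.
have /dvdnP[c ->] := hB _ (dvdn_div eQ) ke.
rewrite mulrAC PoszM (mulrC c%:Z) mulrA -mulrA.
by apply: mulr_in_subgroup; exact: level_transform.
Qed.

End Level.

Lemma level_bound k L : (L %| Q)%N -> logn 2 L = k -> (L %| 2 ^ k * Q`_2^')%N.
Proof.
move=> LQ <-; rewrite -{1}(partnC 2%N (dvdn_gt0 Q0 LQ)) p_part.
by apply: dvdn_mul => //; exact: partn_dvd.
Qed.

(** Passing from [s] to [t] moves values to multiples only and preserves the
    level, so nothing leaves the largest divisor [Q %/ 2 ^ k] of the level. *)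
Lemma level_top_transform s t k : chi_convolves s t ->
  (forall d, (d %| Q)%N -> logn 2 (Q %/ d)%N = k -> (Q %/ d != 2 ^ k)%N -> s d
    = 0) ->
  forall e, (e %| Q)%N -> logn 2 (Q %/ e)%N = k -> t e = s e.
Proof.
move=> st s_top e; have [B] := ubnP e; elim: B e => // B IH e.
rewrite ltnS => leB eQ ke; rewrite (st e eQ) convolution_peel // big1 ?addr0 //.
move=> [/= e' _] /andP[e'e lt]; have e'Q := dvdn_trans e'e eQ.
have [oq|?] := boolP (odd (e %/ e')); last by rewrite chi4_even ?mulr0.
have ke' : logn 2 (Q %/ e')%N = k.
  by rewrite (codivisor eQ e'e) logn2M_odd // codivisor_gt0.
rewrite (IH e') // ?(leq_trans lt) //; rewrite s_top ?mul0r // gtn_eqF //.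
have le2 : (2 ^ k <= Q %/ e)%N.
  by rewrite dvdn_leq ?codivisor_gt0 // pfactor_dvdn ?codivisor_gt0 // ke.
apply: leq_ltn_trans le2 _; rewrite (codivisor eQ e'e) ltn_Pmulr ?codivisor_gt0
  //.
have e'0 := divisor_gt0 e'Q.
by rewrite -(ltn_pmul2r e'0) mul1n divnK.
Qed.

Hypothesis Q2 : (2 %| Q)%N.

Lemma logn2_dvd4 L : (0 < L)%N -> (4 %| L)%N = (1 < logn 2 L)%N.
Proof. by move=> L0; rewrite -(@pfactor_dvdn 2 2). Qed.

(** The levels 0 and 1 consist of the [d] with [Q %/ d] not divisible by 4, and
    [Q], [Q %/ 2] are their largest elements. *)
Definition rigid (s : nat -> int) : Prop := forall d, (d %| Q)%N ->
  ~~ (4 %| Q %/ d)%N -> d != Q -> d != (Q %/ 2)%N -> s d = 0.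

Lemma codivisor_half : (Q %/ (Q %/ 2))%N = 2%N.
Proof. exact: codivisorK. Qed.

Lemma rigid_transform s t : chi_convolves s t -> rigid s ->
  forall e, (e %| Q)%N -> ~~ (4 %| Q %/ e)%N -> t e = s e.
Proof.
move=> st rs e eQ; rewrite logn2_dvd4 ?codivisor_gt0 // -leqNgt => le1.
apply: (level_top_transform st _ eQ (erefl _)) => d dQ kd ntop.
have n4 : ~~ (4 %| Q %/ d)%N by rewrite logn2_dvd4 ?codivisor_gt0 // kd -leqNgt.
apply: rs => //; apply: contraNneq ntop => dE; rewrite -kd dE.
  by rewrite divnn Q0.
by rewrite codivisor_half.
Qed.

(** On the levels above 1 the factor [Q %/ e] is divisible by 4; on the levels 0
    and 1 only [e = Q] and [e = Q %/ 2] survive. *)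
Lemma spectrum_mod4 s t j : chi_convolves s t -> rigid s ->
  (4 %| spectrum t j -
        (s Q * chi4 j + (2 %| j)%:Z * (s (Q %/ 2)%N * 2 * chi4 (j %/ 2)%N)))%Z.
Proof.
move=> st rs; have ts := rigid_transform st rs; rewrite /spectrum.
have h1 : (Q %/ 2 %| Q)%N by exact: dvdn_div.
have ltQ : (Q %/ 2 < Q)%N by rewrite ltn_Pdiv.
rewrite (bigD1 (Ordinal (divisor_lt (dvdnn Q)))) /= ?dvdnn ?divnn ?Q0 ?dvd1n //.
rewrite divn1 mulr1 ts ?divnn ?Q0 //.
set c := s (Q %/ 2)%N * 2 * chi4 _.
set S := \sum_(i | _) _; suff : (4 %| S - (2 %| j)%:Z * c)%Z.
  by rewrite opprD addrACA subrr add0r.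
have rest (P : pred 'I_Q.+1) : (forall i, P i -> [&& (i %| Q)%N, i != Q :> nat
  & i != (Q %/ 2)%N :> nat]) ->
  (4 %| \sum_(i | P i) t i * (Q %/ i)%N%:Z * chi4 (j %/ (Q %/ i))%N)%Z.
  move=> HP; apply: rpred_sum => i /HP /and3P[iQ n1 n2].
  have [d4|n4] := boolP (4 %| Q %/ i)%N.
    by rewrite mulrAC dvdz_mull.
  by rewrite ts // rs // !mul0r rpred0.
rewrite /S; case: (boolP (2 %| j)%N) => j2.
  rewrite (bigD1 (Ordinal (divisor_lt h1))) /=; last first.
    by rewrite h1 codivisor_half j2 -val_eqE /= ltn_eqF.
  rewrite codivisor_half ts ?codivisor_half // mul1r addrAC subrr add0r.
  by apply: rest => i; rewrite -!val_eqE /= => /andP[/andP[/andP[-> _] ->] ->].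
rewrite mul0r subr0; apply: rest => i; rewrite -!val_eqE /= => /andP[/andP[->
  d1] ->].
by apply: contraNneq j2 => i2; move: d1; rewrite i2 codivisor_half.
Qed.

Lemma spectrum_rigid s t (eps : int) : chi_convolves s t -> rigid s ->
  s Q = eps -> (eps == 1) || (eps == -1) ->
  (s (Q %/ 2)%N == 1) || (s (Q %/ 2)%N == -1) ->
  forall j, (4 %| spectrum t j - eps * j%:Z)%Z.
Proof.
move=> st rs sQ he hh j; have := spectrum_mod4 j st rs; rewrite sQ.
set M := spectrum t j; set h := s _ in hh *.
have [oj|ej] := boolP (odd j).
  have -> : (2 %| j)%N = false by rewrite dvdn2 oj.
  by have := chi4_mod4 oj; case/orP: he => /eqP->; lia.
rewrite (chi4_even ej) dvdn2 ej /=.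
have [oh|eh] := boolP (odd (j %/ 2)).
  by have := chi4_mod4 oh; case/orP: he => /eqP->; case/orP: hh => /eqP->; lia.
by rewrite (chi4_even eh); case/orP: he => /eqP->; case/orP: hh => /eqP->; lia.
Qed.

Lemma chi_convolvesB s t s' t' c : chi_convolves s t -> chi_convolves s' t' ->
  chi_convolves (fun d => s d - c * s' d) (fun d => t d - c * t' d).
Proof.
move=> st st' d dQ; rewrite st // st' // mulr_sumr -sumrB.
by apply: eq_bigr => e _; rewrite mulrBl mulrA.
Qed.

Lemma spectrumB t t' c j :
  spectrum (fun d => t d - c * t' d) j = spectrum t j - c * spectrum t' j.
Proof.
rewrite /spectrum mulr_sumr -sumrB; apply: eq_bigr => e _.
by rewrite !mulrBl !mulrA.
Qed.

(** Comparison with the function [s0] that is 1 at [Q] and [Q %/ 2]: its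
    spectrum is congruent to [j], so that of [s - eps * s0] vanishes modulo 4
    and [level_coefficient] applies with the subgroup of multiples of 4.  The
    bound on [s] then leaves a single value for each residue found. *)
Lemma rigid_of_spectrum s t (eps : int) : chi_convolves s t ->
  (forall d, -1 <= s d <= 1) -> (eps == 1) || (eps == -1) ->
  (forall j, (4 %| spectrum t j - eps * j%:Z)%Z) ->
  [/\ rigid s, s Q = eps & (s (Q %/ 2)%N == 1) || (s (Q %/ 2)%N == -1)].
Proof.
move=> st s1 he HM.
have ltQ : (Q %/ 2 < Q)%N by rewrite ltn_Pdiv.
pose s0 d : int := (d == Q)%:Z + (d == (Q %/ 2)%N)%:Z.
have s0Q : s0 Q = 1 by rewrite /s0 eqxx gtn_eqF.
have s0h : s0 (Q %/ 2)%N = 1 by rewrite /s0 eqxx ltn_eqF.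
have rs0 : rigid s0 by move=> d _ _ /negPf n1 /negPf n2; rewrite /s0 n1 n2.
have [t0 st0] := chi_convolves_exists s0.
have H0 : forall j, (4 %| spectrum t0 j - 1 * j%:Z)%Z.
  by apply: (spectrum_rigid st0) => //; rewrite s0h.
have stB := chi_convolvesB eps st st0.
have HB k j : (0 < j)%N -> logn 2 j = k -> spectrum (fun d => t d - eps * t0 d)
  j \in dvdz 4.
  move=> _ _; rewrite spectrumB.
  by have := HM j; have := H0 j; case/orP: he => /eqP->; rewrite /in_mem /=;
    lia.
have key d : (d %| Q)%N ->
   (4 %| (s d - eps * s0 d) * (2 ^ logn 2 (Q %/ d) * Q`_2^')%N%:Z)%Z.
  move=> dQ; apply: (level_coefficient stB (HB (logn 2 (Q %/ d)%N))) => //.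
  by move=> L; exact: level_bound.
have om : coprimez 4 (Q`_2^')%N.
  by rewrite coprimezE; change (coprime (2 ^ 2) Q`_2^')%N;
    rewrite coprime_pexpl // coprime2n odd_2'nat part_pnat.
have key4 d : (d %| Q)%N -> (4 %| (s d - eps * s0 d) * (2 ^ logn 2 (Q %/
  d))%N%:Z)%Z.
  by move=> /key; rewrite PoszM mulrA Gauss_dvdzl.
split.
- move=> d dQ n4 n1 n2; have := key4 d dQ;
  rewrite /s0 (negPf n1) (negPf n2) mulr0 subr0.
  have := s1 d; have : (logn 2 (Q %/ d) <= 1)%N.
    by rewrite leqNgt -logn2_dvd4 // codivisor_gt0.
  by case: (logn 2 _) => [|[|//]] _; lia.
- have := key4 Q (dvdnn Q); rewrite divnn Q0 logn1 s0Q.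
  by have := s1 Q; case/orP: he => /eqP->; lia.
- have := key4 (Q %/ 2)%N (dvdn_div Q2); rewrite codivisor_half s0h.
  by have := s1 (Q %/ 2)%N; rewrite (_ : logn 2 2 = 1%N) //;
    case/orP: he => /eqP->; lia.
Qed.

Lemma spectrum0 t : spectrum t 0 = 0.
Proof. by rewrite /spectrum big1 // => e _; rewrite div0n mulr0. Qed.

Lemma spectrum1 t : spectrum t 1 = t Q.
Proof.
rewrite /spectrum (bigD1 (Ordinal (divisor_lt (dvdnn Q)))) /= ?dvdnn ?divnn ?Q0
  //.
rewrite !mulr1 big1 ?addr0 // => e /andP[/andP[eQ e1] ne].
case/eqP: ne; apply: val_inj => /=.
by move: e1; rewrite dvdn1 => /eqP e1; have := divnK eQ; rewrite e1 mul1n.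
Qed.

(** A unit [u] changes none of the divisibilities [Q %/ e %| j] and contributes
    [chi4 u] to every term. *)
Lemma spectrumM t u j : coprime u Q -> spectrum t (u * j)%N = chi4 u * spectrum
  t j.
Proof.
move=> uQ; rewrite /spectrum mulr_sumr; apply: eq_big => [e|e /andP[eQ Lj]].
  case eQ: (e %| Q)%N => //=; rewrite Gauss_dvdr // coprime_sym.
  exact: coprime_dvdr (dvdn_div eQ) uQ.
have Lj' : (Q %/ e %| j)%N.
  move: Lj; rewrite Gauss_dvdr // coprime_sym.
  exact: coprime_dvdr (dvdn_div eQ) uQ.
by rewrite -muln_divA // chi4M; ring.
Qed.

End Arith.

(** For [m] the odd part of [Q], the witness satisfies [4 * c = 3 * m ^ 2 + 1],
    hence [4 * c] and [4 * c + 1] are 1 and 2 modulo [m]; it is odd because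
    [m ^ 2] is 1 modulo 8. *)
Lemma unit_minus_one_quarter Q : 0 < Q ->
  exists c, [/\ coprime (4 * c + 1) Q, coprime c Q & chi4 (4 * c + 1) = 1%R].
Proof.
move=> Q0; set m := Q`_2^'.
have om : odd m by rewrite odd_2'nat part_pnat.
have m0 : 0 < m := part_gt0 _ _.
pose h := m./2; have mh : m = h.*2.+1 by rewrite /h -{1}[m]odd_double_half om.
pose c := 3 * (h * h.+1) + 1.
have cE : 4 * c = 3 * m * m + 1 by rewrite /c mh; lia.
have oc : odd c by rewrite /c oddD !oddM /= andbN.
have cop x : odd x -> coprime m x -> coprime x Q.
  move=> ox mx; rewrite -(partnC 2 Q0) coprimeMr coprime_sym p_part.
  by rewrite coprimeXl ?coprime2n // coprime_sym.
have mc : coprime m (4 * c) by rewrite cE /coprime gcdnMDl gcdn1.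
exists c; split.
- apply: cop; first by lia.
  by rewrite cE -addnA /coprime gcdnMDl -/(coprime _ _) coprimen2.
- by apply: cop => //; move: mc; rewrite coprimeMr => /andP[].
- by rewrite /chi4; case: eqP => //; lia.
Qed.

(** * Fourier transform of the signed symbol *)
Section Roots.
Local Open Scope complex_scope.
Local Open Scope ring_scope.
Variable R : realType.

(** If a [k]-th power with 0 < k < n is 1 then cos(2x) = 1 for x = pi k / n, so
    sin x = 0, which is impossible for x strictly between 0 and pi. *)
Lemma cis_prim n : (0 < n)%N -> n.-primitive_root (cis (2 * pi / n%:R) : R[i]).
Proof.
move=> n0; have nR : n%:R != 0 :> R by rewrite pnatr_eq0 -lt0n.
rewrite /primitive_root_of_unity n0 /=; apply/forallP => -[i /= lt_in].
apply/eqP; rewrite unity_rootE -cisMn -[_ *+ i.+1]mulr_natl.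
have [->|ne] := eqVneq i.+1 n.
  have -> : n%:R * (2 * pi / n%:R) = 0 + pi *+ 2 :> R.
    by rewrite -mulr_natl add0r; field.
  by apply/eqP; rewrite /cis cosD2pi sinD2pi cos0 sin0.
rewrite eq_complex /=; apply/negP => /andP[/eqP c1 _].
pose x : R := pi * i.+1%:R / n%:R.
have x0 : 0 < x by rewrite divr_gt0 ?mulr_gt0 ?pi_gt0 ?ltr0n.
have xpi : x < pi.
  rewrite /x ltr_pdivrMr ?ltr0n // ltr_pM2l ?pi_gt0 // ltr_nat.
  by rewrite ltn_neqAle ne.
have s0 : 0 < sin x by apply: sin_gt0_pi; rewrite x0.
have : cos (x *+ 2) = 1 by rewrite -c1; congr cos; rewrite /x -mulr_natl; field.
have := cos2Dsin2 x; have : 0 < sin x ^+ 2 by rewrite exprn_gt0.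
by rewrite cos_mulr2n; lra.
Qed.

Lemma Ci_prim : 4.-primitive_root ('i : R[i]).
Proof.
rewrite -cis_half_pi; have -> : pi / 2 = 2 * pi / 4%:R :> R by field.
exact: cis_prim.
Qed.

Lemma geometric_root_sum (y : R[i]) L : y ^+ L = 1 ->
  \sum_(0 <= l < L) y ^+ l = if y == 1 then L%:R else 0.
Proof.
move=> yL; case: eqP => [->|/eqP y1].
  by under eq_bigr do rewrite expr1n; rewrite sumr_const_nat subn0.
apply/eqP; rewrite -(mulrI_eq0 _ (mulfI (_ : y - 1 != 0))) ?subr_eq0 //.
by rewrite big_mkord -subrX1 yL subrr.
Qed.

Lemma character_geometric (z : R[i]) L :
  \sum_(0 <= k < 4 * L) (chi4 k)%:~R * z ^+ k =
  (z - z ^+ 3) * \sum_(0 <= l < L) (z ^+ 4) ^+ l.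
Proof.
elim: L => [|L IH]; first by rewrite muln0 !big_geq // mulr0.
rewrite mulnS addnC 4!addnS addn0 !big_nat_recr ?leq0n //= IH.
rewrite mulrDr -!addrA; congr (_ + _).
have -> : chi4 (4 * L) = 0 by rewrite /chi4; do 2 (case: eqP => ?; first lia).
have -> : chi4 (4 * L).+1 = 1 by rewrite /chi4; case: eqP => // ?; lia.
have -> : chi4 (4 * L).+2 = 0 by rewrite /chi4; do 2 (case: eqP => ?;
  first lia).
have -> : chi4 (4 * L).+3 = -1.
  by rewrite /chi4; case: eqP => ?; first lia; case: eqP => ?; lia.
by rewrite !mul0r !add0r mul1r -exprM !exprS; ring.
Qed.

Lemma sum_multiples (g : nat -> R[i]) e K : (0 < e)%N ->
  \sum_(0 <= x < e * K | (e %| x)%N) g x = \sum_(0 <= k < K) g (e * k)%N.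
Proof.
move=> e0; elim: K => [|K IH]; first by rewrite muln0 !big_geq.
rewrite mulnS addnC (big_cat_nat (leq0n _) (leq_addr e (e * K))) /= IH.
rewrite big_nat_recr //=; congr (_ + _).
have lt_block : (e * K < e * K + e)%N by rewrite -{1}[(e * K)%N]addn0 ltn_add2l.
rewrite big_mkcond (big_ltn lt_block) dvdn_mulr //.
rewrite /= big_nat_cond big1 /= ?addr0 // => x /andP[/andP[lo hi] _].
case: ifP => // /dvdnP[c xc]; move: lo hi; rewrite xc.
by case: (leqP c K) => cK; have := leq_mul cK (leqnn e); nia.
Qed.

End Roots.

Section EigenvalueSum.
Local Open Scope complex_scope.
Local Open Scope ring_scope.
Variables (R : realType) (Q : nat).
Hypothesis Q0 : (0 < Q)%N.

(** A primitive root of unity of order 4Q. *)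
Definition root_4Q : R[i] := cis (2 * pi / (4 * Q)%:R).
Local Notation w := root_4Q.

Lemma root_prim : (4 * Q).-primitive_root w.
Proof. by apply: cis_prim; rewrite muln_gt0. Qed.

Lemma root_quarter : w ^+ Q = 'i.
Proof.
rewrite -cisMn -cis_half_pi; congr cis.
by rewrite -[_ *+ Q]mulr_natl natrM; field; rewrite pnatr_eq0 -lt0n.
Qed.

Lemma root_neq0 : w != 0.
Proof. exact: cis_neq0. Qed.

(** The signed indicator of the symbol written without coprimality conditions,
    see [symbol_functionE]. *)
Definition symbol_function (t : nat -> int) (x : nat) : int :=
  \sum_(e : 'I_Q.+1 | (e %| Q)%N && (e %| x)%N) t e * chi4 (x %/ e)%N.

Lemma invCi : 'i^-1 = - 'i :> R[i].
Proof.
have i0 : 'i != 0 :> R[i] by rewrite -cis_half_pi cis_neq0.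
by apply: (mulfI i0); rewrite mulfV // mulrN -expr2 sqr_i opprK.
Qed.

(** The Gauss sum of the character modulo 4, twisted by [k]. *)
Lemma chi4_gauss k :
  'i * (('i^-1) ^+ k - (('i^-1) ^+ k) ^+ 3) = 2 * (chi4 k)%:~R :> R[i].
Proof.
rewrite invCi; set u : R[i] := - 'i.
have -> : 'i = - u by rewrite opprK.
have uu : u * u = -1 by rewrite mulrNN -expr2 sqr_i.
move: u uu => u uu; have u3 : u ^+ 3 = - u by rewrite !exprS expr0 mulr1 uu
  mulrN1.
have u4 : u ^+ 4 = 1 by rewrite exprS u3 mulrN uu opprK.
rewrite -chi4_modn (divn_eq k 4) modnMDl modn_mod (mulnC _ 4) exprD exprM u4
  expr1n mul1r.
have diff : - u * (u - - u) = 2 by rewrite opprK -mulr2n mulrnAr mulNr uu opprK.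
have := ltn_pmod k (isT : (0 < 4)%N).
case: (k %% 4)%N => [|[|[|[|?]]]] // _; rewrite /chi4 /=.
- by rewrite expr0 expr1n subrr !mulr0.
- by rewrite expr1 u3 diff mulr1.
- by rewrite expr2 uu exprS sqrrN expr1n mulr1 subrr !mulr0.
- have nu3 : (- u) ^+ 3 = u by rewrite exprNn u3 -signr_odd /= expr1 mulN1r
  opprK.
  have -> : - u * (u ^+ 3 - u ^+ 3 ^+ 3) = - (- u * (u - - u)).
    by rewrite u3 nu3 -mulrN opprD opprK.
  by rewrite diff rmorphN1 mulrN1.
Qed.

Lemma root_power_quarter j L : (L %| Q)%N -> (L %| j)%N ->
  w^-1 ^+ (j * (Q %/ L)) = 'i^-1 ^+ (j %/ L).
Proof.
move=> LQ Lj; rewrite -root_quarter !exprVn -exprM; congr (_ ^+ _)^-1.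
by rewrite mulnC divn_mulAC // mulnC muln_divA // mulnC.
Qed.

(** Substituting x = e k, k < 4L with L = Q/e, and splitting k modulo 4 leaves a
    geometric sum over the L-th root of unity w^(-4je), which is 1 exactly when
    L divides j. *)
Lemma class_sum j e : (e %| Q)%N ->
  'i * \sum_(0 <= x < 4 * Q | (e %| x)%N) (chi4 (x %/ e)%N)%:~R * w^-1 ^+ (j *
    x) =
  if (Q %/ e %| j)%N then 2 * (Q %/ e)%:R * (chi4 (j %/ (Q %/ e)))%:~R else 0.
Proof.
move=> eQ; have e0 := divisor_gt0 Q0 eQ; set L := (Q %/ e)%N.
have QE : (4 * Q = e * (4 * L))%N by rewrite mulnCA (mulnC e) /L divnK.
rewrite QE sum_multiples //.
have -> : \sum_(0 <= k < 4 * L)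
    (chi4 (e * k %/ e)%N)%:~R * w^-1 ^+ (j * (e * k)) =
    \sum_(0 <= k < 4 * L) (chi4 k)%:~R * (w^-1 ^+ (j * e)) ^+ k.
  by apply: eq_bigr => k _; rewrite mulKn // -exprM mulnA.
rewrite character_geometric geometric_root_sum; last first.
  rewrite -!exprM exprVn -mulnA -QE mulnC exprM.
  by rewrite (prim_expr_order root_prim) expr1n invr1.
have -> : ((w^-1 ^+ (j * e)) ^+ 4 == 1) = (L %| j)%N.
  rewrite -exprM exprVn invr_eq1 -(prim_order_dvd root_prim) QE.
  rewrite mulnA (_ : (j * e * 4 = e * 4 * j)%N); last by lia.
  by rewrite dvdn_pmul2l // muln_gt0 e0.
case: ifP => [Lj|_]; last by rewrite !mulr0.
have -> : w^-1 ^+ (j * e) = 'i^-1 ^+ (j %/ L).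
  by rewrite -root_power_quarter ?dvdn_div // codivisorK.
by rewrite mulrA chi4_gauss mulrAC.
Qed.

Lemma eigenvalue_sum t j :
  \sum_(0 <= x < 4 * Q) 'i * (symbol_function t x)%:~R * w^-1 ^+ (j * x) =
  (2 * spectrum Q t j)%:~R.
Proof.
under eq_bigr => x _.
  rewrite /symbol_function rmorph_sum /= mulr_sumr mulr_suml big_mkcondr /=.
    over.
rewrite exchange_big /= /spectrum mulr_sumr rmorph_sum /= [RHS]big_mkcondr /=.
apply: eq_bigr => e eQ; rewrite -big_mkcond /=.
transitivity ((t e)%:~R * ('i * \sum_(0 <= x < 4 * Q | (e %| x)%N)
     (chi4 (x %/ e)%N)%:~R * w^-1 ^+ (j * x))).
  by rewrite mulrA mulr_sumr; apply: eq_bigr => x _; rewrite rmorphM /=; ring.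
by rewrite class_sum //; case: ifP => _; rewrite ?mulr0 // !rmorphM /=; ring.
Qed.
End EigenvalueSum.

(** * Diagonalization and perfect state transfer *)
Section Fourier.
Local Open Scope complex_scope.
Local Open Scope ring_scope.
Variables (R : realType) (n' Q : nat).
Local Notation N := n'.+2.
Hypothesis NQ : N = (4 * Q)%N.
Local Notation w := (root_4Q R Q).

Lemma order_quarter_gt0 : (0 < Q)%N.
Proof. by case: Q NQ. Qed.
Local Notation Q0 := order_quarter_gt0.

Lemma root_primN : N.-primitive_root w.
Proof. by rewrite NQ; exact: root_prim Q0. Qed.

(** Subtraction in [v - u] wraps around modulo [n'.+2]; the root of unity does
    not see this. *)
Lemma root_shift (u v : 'I_N) : w ^+ (v - u)%R * w ^+ u = w ^+ v.
Proof.
rewrite -exprD -(prim_expr_mod root_primN); congr (_ ^+ _).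
exact: (congr1 val (subrK u v)).
Qed.

Definition fourier : 'M[R[i]]_N := \matrix_(j, u) w ^+ (j * u).
Definition fourier_inv : 'M[R[i]]_N :=
  \matrix_(u, j) (N%:R^-1 * w^-1 ^+ (j * u)).

Lemma fourier_invK : fourier_inv *m fourier = 1%:M.
Proof.
apply: mulmx1C; apply/matrixP => j k; rewrite !mxE.
have N0 : N%:R != 0 :> R[i] by rewrite pnatr_eq0.
have w0 := root_neq0 R Q.
transitivity (N%:R^-1 * \sum_(0 <= u < N) (w ^+ j / w ^+ k) ^+ u).
  rewrite big_mkord mulr_sumr; apply: eq_bigr => u _; rewrite !mxE.
  by rewrite mulrCA exprMn !exprM exprVn exprVn.
rewrite geometric_root_sum; last first.
  rewrite exprMn exprVn -!exprM !(mulnC _ N) !exprM (prim_expr_order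
    root_primN).
  by rewrite !expr1n invr1 mulr1.
rewrite -subr_eq0 -[X in _ - X](mulfV (expf_neq0 k w0)) -mulrBl mulf_eq0
  invr_eq0.
rewrite (negPf (expf_neq0 k w0)) orbF subr_eq0 (eq_prim_root_expr root_primN).
rewrite !modn_small // -val_eqE; case: eqP => _; first by rewrite mulVf.
by rewrite mulr0.
Qed.

Variables (e : rel 'I_N) (t : nat -> int).
Hypothesis eE : forall u v, hermitian_adjacency R e u v =
  'i * (symbol_function Q t (v - u)%R)%:~R.

Lemma fourier_adjacency :
  fourier *m hermitian_adjacency R e =
  diag_mx (\row_j (2 * spectrum Q t j)%:~R) *m fourier.
Proof.
apply/matrixP => j v; rewrite mul_diag_mx !mxE.
rewrite -(eigenvalue_sum R Q0) -NQ big_mkord mulr_suml.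
rewrite (reindex_inj (can_inj (subKr v))) /=.
apply: eq_bigr => x _; rewrite eE !mxE subKr.
have -> : w ^+ (j * v) = w ^+ (j * (v - x)%R) * w ^+ (j * x).
  by rewrite !(mulnC j) !exprM -(root_shift x v) exprMn.
rewrite exprVn; have w0 := expf_neq0 (j * x) (root_neq0 R Q).
by rewrite mulrC -[RHS]mulrA (mulrC (w ^+ (j * (v - x)%R))) (mulKf w0).
Qed.

Lemma transition_fourier s :
  transition_matrix e s =
  fourier_inv *m diag_mx (\row_j cis (s * (2 * spectrum Q t j)%:~R)) *m fourier.
Proof.
rewrite /transition_matrix; apply: expmx_diagonalized;
  first exact: fourier_invK.
rewrite -scalemxAr fourier_adjacency scalemxAl; congr (_ *m _).
apply/matrixP => j k; rewrite !mxE; case: (j == k);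
  last by rewrite !mulr0n mulr0.
by rewrite !mulr1n (rmorphM (real_complex R)) (rmorph_int (real_complex R))
  mulrA.
Qed.

Lemma fourier_inj (x y : 'cV[R[i]]_N) : fourier *m x = fourier *m y -> x = y.
Proof.
by move=> /(congr1 (mulmx fourier_inv)); rewrite !mulmxA fourier_invK !mul1mx.
Qed.

Lemma spectrum_periodic j k : j = k %[mod N] -> spectrum Q t j = spectrum Q t k.
Proof.
move=> jk; apply: (@mulfI int 2) => //; apply: (@intr_inj R[i]).
rewrite -!(eigenvalue_sum R Q0); apply: eq_bigr => x _; congr (_ * _).
rewrite !exprM; congr (_ ^+ _); rewrite !exprVn; congr _^-1.
by apply/eqP; rewrite (eq_prim_root_expr root_primN) jk.
Qed.

(** Entry [j] of the Fourier transform of [U(s) e_u] is the phase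
    cis(2s)^M(j) times w^(ju).  For j = 0 the eigenvalue is 0, which forces
    gamma = 1; the other entries give the stated condition, with th = 2s. *)
Lemma transfer_phase (u v : 'I_N) : perfect_state_transfer R e u v <->
  exists th : R, forall j, cis th ^ spectrum Q t j = w ^+ (j * (v - u)%R).
Proof.
have w0 := root_neq0 R Q.
have shift j : w ^+ (j * (v - u)%R) * w ^+ (j * u) = w ^+ (j * v).
  by rewrite !(mulnC j) !exprM -(root_shift u v) exprMn.
have phase (s : R) j : cis (s * (2 * spectrum Q t j)%:~R) =
    cis (s * 2) ^ spectrum Q t j.
  by rewrite -cisMz; congr cis; rewrite -[RHS]mulrzr intrM mulrA.
have evol s j : (fourier *m (transition_matrix e s *m std_basis R u)) j 0 =
    cis (s * 2) ^ spectrum Q t j * w ^+ (j * u).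
  rewrite transition_fourier !mulmxA (mulmx1C fourier_invK) mul1mx.
  by rewrite mul_diag_mx -colE !mxE phase.
split=> [[s [g [_ E]]]|[th E]].
  have key (j : 'I_N) : cis (s * 2) ^ spectrum Q t j * w ^+ (j * u) = g * w ^+
    (j * v).
    by rewrite -evol E -scalemxAr -colE !mxE.
  have g1 : g = 1.
    by have := key 0; rewrite spectrum0 expr0z !mul0n !mulr1 => <-.
  exists (s * 2) => j; pose j' : 'I_N := inord (j %% N).
  have jj' : j' = j %[mod N] by rewrite /j' inordK ?modn_mod // ltn_pmod.
  have -> : w ^+ (j * (v - u)%R) = w ^+ (j' * (v - u)%R).
    by apply/eqP; rewrite (eq_prim_root_expr root_primN) -modnMml -jj' modnMml.
  rewrite -(spectrum_periodic jj'); apply: (mulIf (expf_neq0 (j' * u) w0)).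
  by rewrite shift key g1 mul1r.
exists (th / 2), 1; split; first exact: normr1.
rewrite scale1r; apply: fourier_inj; apply/matrixP => j k.
by rewrite ord1 evol divfK ?pnatr_eq0 // E shift -colE !mxE.
Qed.

End Fourier.

(** * Multiple state transfer as a congruence on the spectrum *)
Section MultipleTransfer.
Local Open Scope complex_scope.
Local Open Scope ring_scope.
Variables (R : realType) (n' Q : nat).
Local Notation N := n'.+2.
Hypothesis NQ : N = (4 * Q)%N.
Local Notation w := (root_4Q R Q).
Local Notation Q0 := (order_quarter_gt0 NQ).

Lemma Ci_expz_eq1 (k : int) : ('i : R[i]) ^ k = 1 <-> (4 %| k)%Z.
Proof.
have dvd4 l : ('i : R[i]) ^+ l = 1 <-> (4 %| l)%N.
  by rewrite (prim_order_dvd (Ci_prim R)); split => [->|/eqP].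
case: k => k; first exact: dvd4.
rewrite NegzE -exprnN dvdzE abszN -dvd4.
by split=> [/eqP|->]; rewrite ?invr1 // invr_eq1 => /eqP.
Qed.

Lemma Ci_expz_eq (k l : int) : ('i : R[i]) ^ k = 'i ^ l <-> (4 %| k - l)%Z.
Proof.
have i0 : 'i != 0 :> R[i] by rewrite -cis_half_pi cis_neq0.
rewrite -Ci_expz_eq1 expfzDr // -invr_expz; split=> [->|E].
  by rewrite divff // expfz_neq0.
by apply: divr1_eq.
Qed.

Definition torsion4_exponent (th : R) : {pred int} :=
  fun k => cis th ^ (k * 4) == 1.

Lemma torsion4_zmod_closed th : zmod_closed (torsion4_exponent th).
Proof.
split; first by rewrite /in_mem /= /torsion4_exponent mul0r expr0z.
move=> x y; rewrite /in_mem /= /torsion4_exponent => /eqP x1 /eqP y1.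
by rewrite mulrBl expfzDr ?cis_neq0 // x1 -invr_expz y1 invr1 mulr1.
Qed.

HB.instance Definition _ th :=
  GRing.isZmodClosed.Build int (torsion4_exponent th) (torsion4_zmod_closed th).

(** Some value of [s] on level 0 is a sign, as otherwise the spectrum vanishes
    at 1.  Hence z^m is a fourth root of unity for m the odd part of [Q].  As
    m^2 = 1 mod 4, replacing z by z^(m^2) keeps the equations and makes z a
    power i^q; then q M(j) = j mod 4 with q odd. *)
Lemma phase_congruence s t th : chi_convolves Q s t ->
  (forall d, -1 <= s d <= 1) ->
  (forall j, cis th ^ spectrum Q t j = ('i : R[i]) ^+ j) ->
  exists2 eps : int, (eps == 1) || (eps == -1) &
    forall j, (4 %| spectrum Q t j - eps * j%:Z)%Z.
Proof.
move=> st s1 E; set m := (Q`_2^')%N.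
have om : odd m by rewrite odd_2'nat part_pnat.
have [d /and3P[dQ /eqP kd sd]] :
    exists d, [&& (d %| Q)%N, logn 2 (Q %/ d)%N == 0%N & s d != 0].
  apply: contrapT => none.
  have t0 : t Q = 0.
    have lQ : logn 2 (Q %/ Q)%N = 0%N by rewrite divnn Q0.
    have s0 d : (d %| Q)%N -> logn 2 (Q %/ d)%N = 0%N -> s d = 0.
      move=> dQ kd; apply: contrapT => /eqP sd; apply: none; exists d.
      by rewrite dQ kd eqxx.
    by rewrite (level_top_transform Q0 st (fun d dQ kd _ => s0 d dQ kd)) ?s0.
  have := E 1%N; rewrite (spectrum1 Q0) t0 expr0z expr1 => i1.
  have /Ci_expz_eq1 : ('i : R[i]) ^ 1 = 1 by rewrite expr1z.
  by [].
have mA : m%:Z \in torsion4_exponent th.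
  have AM j : (0 < j)%N -> logn 2 j = 0%N -> spectrum Q t j \in
    torsion4_exponent th.
    move=> _ _; rewrite /in_mem /= /torsion4_exponent -exprz_exp E.
    by rewrite -exprnP -exprM mulnC exprM (prim_expr_order (Ci_prim R)) expr1n.
  have := level_coefficient Q0 st AM dQ kd (B := m).
  have -> : s d * m%:Z = if s d == 1 then m%:Z else - m%:Z.
    case: eqP => [->|n1]; first by rewrite mul1r.
    have -> : s d = -1 by have /andP[lo hi] := s1 d; move/eqP: sd; lia.
    by rewrite mulN1r.
  move=> H; have : (if s d == 1 then m%:Z else - m%:Z) \in torsion4_exponent th.
    by apply: H => L LQ kL; have := level_bound Q0 LQ kL; rewrite mul1n.
  by case: ifP => // _; rewrite rpredN.
have y4 : (cis th ^+ (m * m)) ^+ 4 = 1.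
  move: mA; rewrite /in_mem /= /torsion4_exponent -PoszM -exprnP => /eqP m4.
  by rewrite -exprM -mulnA mulnC exprM m4 expr1n.
have [q yq] := prim_rootP (Ci_prim R) y4.
have key j : (4 %| (val q)%:Z * spectrum Q t j - j%:Z)%Z.
  have /Ci_expz_eq : ('i : R[i]) ^ ((val q)%:Z * spectrum Q t j) = 'i ^ (m * m
    * j)%N%:Z.
    rewrite -exprz_exp -exprnP -yq exprnP exprz_exp mulrC -exprz_exp E.
    by rewrite -!exprnP -exprM mulnC.
  have : (4 %| (m * m * j)%N%:Z - j%:Z)%Z.
    have : (m * m = 4 * (m./2 * m./2 + m./2) + 1)%N.
      by rewrite -{1 2}[m]odd_double_half om; lia.
    by move=> ->; rewrite mulnDl mul1n PoszD addrK -mulnA PoszM dvdz_mulr.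
  by move=> H1 H2; rewrite -(subrK (m * m * j)%N%:Z (_ * _)) -addrA rpredD.
(* q = 1 or q = 3, the congruence at j = 1 makes q odd. *)
exists (if odd ((val q)./2) then -1 else 1); first by case: ifP.
move=> j; have := key j; have := key 1%N; case: q {yq key} => [[|[|[|[|?]]]]
  //= _]; lia.
Qed.

Section Graph.
Variables (e : rel 'I_N) (s t : nat -> int).
Hypothesis st : chi_convolves Q s t.
Hypothesis s1 : forall d, -1 <= s d <= 1.
Hypothesis eE : forall u v, hermitian_adjacency R e u v =
  'i * (symbol_function Q t (v - u)%R)%:~R.

(** Evaluating the phase condition at 1 and at a unit k = 1 mod 4 gives equal
    left-hand sides, so (k - 1)(v - u) vanishes modulo 4Q. *)
Lemma transfer_quarter (u v : 'I_N) : perfect_state_transfer R e u v ->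
  exists2 c, nat_of_ord (v - u)%R = (c * Q)%N & exists th : R,
    forall j, cis th ^ spectrum Q t j = ('i : R[i]) ^+ (c * j).
Proof.
move=> /(transfer_phase NQ eE) [th E]; set x := nat_of_ord (v - u)%R in E *.
have [c [cop copc chi1]] := unit_minus_one_quarter Q0.
have : w ^+ ((4 * c + 1) * x) == w ^+ (1 * x).
  by rewrite -!E -[X in spectrum Q t X]muln1 spectrumM // chi1 mul1r.
rewrite (eq_prim_root_expr (root_primN R NQ)) eqn_mod_dvd; last first.
  by rewrite leq_mul // leq_addl.
rewrite -mulnBl addnK NQ -mulnA dvdn_pmul2l // Gauss_dvdr 1?coprime_sym //.
move=> /dvdnP[k xk]; exists k => //; exists th => j.
by rewrite E xk -(root_quarter R Q0) -exprM mulnA mulnC (mulnC j).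
Qed.

(** Of two distinct nonzero multiples of [Q] modulo [4 * Q] one is odd.
    Conversely the congruence yields transfer between any multiples of [Q]. *)
Lemma multiple_transfer_spectrum :
  multiple_state_transfer R e <->
  exists2 eps : int, (eps == 1) || (eps == -1) &
    forall j, (4 %| spectrum Q t j - eps * j%:Z)%Z.
Proof.
split=> [[S [/card_gt2P [a [b [c [[aS bS cS] [ab bc ca]]]]] pst]]|[eps he HM]].
  have [k [ok [th E]]] : exists k, odd k /\ exists th : R,
      forall j, cis th ^ spectrum Q t j = ('i : R[i]) ^+ (k * j).
    have [k kQ Ek] := transfer_quarter (pst a b aS bS ab).
    have ac : a != c by rewrite eq_sym.
    have [l lQ El] := transfer_quarter (pst a c aS cS ac).
    have [o|ek] := boolP (odd k); first by exists k.
    have [o|el] := boolP (odd l); first by exists l.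
    have := ltn_ord (b - a); have := ltn_ord (c - a).
    have nb : nat_of_ord (b - a) != 0%N by rewrite (val_eqE (b - a) 0) subr_eq0
      eq_sym.
    have nc : nat_of_ord (c - a) != 0%N by rewrite (val_eqE (c - a) 0) subr_eq0.
    have nbc : nat_of_ord (b - a) != nat_of_ord (c - a).
      by rewrite val_eqE (inj_eq (addIr _)).
    rewrite kQ lQ in nb nc nbc *; rewrite NQ !ltn_pmul2r ?Q0 // => l4 k4.
    by move: k l k4 l4 nb nc nbc ek el {kQ lQ Ek El} => [|[|[|[|?]]]] //
      [|[|[|[|?]]]] //; rewrite ?eqxx.
  have k4 : (k %% 4 = 1 \/ k %% 4 = 3)%N by lia.
  have kE j : ('i : R[i]) ^+ (k * j) = 'i ^+ (k %% 4) ^+ j.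
    by rewrite exprM (prim_expr_mod (Ci_prim R)).
  case: k4 => k4.
    by apply: (phase_congruence (th := th) st s1) => j; rewrite E kE k4 expr1.
  (* k = 3 mod 4: the inverse phase realizes i^j. *)
  apply: (phase_congruence (th := - th) st s1) => j.
  rewrite cisN exprz_inv -invr_expz E kE k4 -exprVn; congr (_ ^+ _).
  by rewrite exprSr sqr_i mulN1r -invCi invrK.
pose x c : 'I_N := inord (c * Q).
have xE c : (c < 4)%N -> nat_of_ord (x c) = (c * Q)%N.
  by move=> c4; rewrite /x inordK // NQ ltn_pmul2r // Q0.
exists [set x c | c : 'I_4]; split.
  rewrite card_imset ?card_ord // => c d /(congr1 val) /=.
  rewrite !xE // => /eqP; rewrite eqn_pmul2r ?Q0 // => /eqP; exact: val_inj.
move=> u v /imsetP[c _ ->] /imsetP[d _ ->] _.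
apply/(transfer_phase NQ eE).
(* The phase i^(eps (d - c)), whose M(j)-th power is i^(j (d - c)). *)
exists (pi / 2 *~ (eps * (d%:Z - c%:Z))) => j.
have wj : w ^+ (j * (x d - x c)%R) * w ^+ (j * x c) = w ^+ (j * x d).
  by rewrite !(mulnC j) !exprM -(root_shift R NQ (x c) (x d)) exprMn.
apply: (mulIf (expf_neq0 (j * x c) (root_neq0 R Q))); rewrite wj !xE //.
have wq k : w ^+ (j * (k * Q)) = 'i ^ (j * k)%N%:Z.
  by rewrite mulnA mulnC exprM root_quarter // Q0.
rewrite !wq cisMz cis_half_pi exprz_exp -expfzDr; last first.
  by rewrite -cis_half_pi cis_neq0.
apply/Ci_expz_eq; have := HM j; set M := spectrum Q t j => /dvdzP[q Mq].
have -> : M = q * 4 + eps * j%:Z by rewrite -Mq subrK.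
apply/dvdzP; exists (eps * (d%:Z - c%:Z) * q).
by rewrite !PoszM; case/orP: he => /eqP->; ring.
Qed.

End Graph.
End MultipleTransfer.

(** * The symbol of an integral oriented circulant graph *)
Section SymbolFunction.
Local Open Scope ring_scope.
Variable Q : nat.
Hypothesis Q0 : (0 < Q)%N.
Local Notation n := (4 * Q)%N.

Definition signed_symbol (s : nat -> int) (x : nat) : int :=
  if (gcdn x n %| Q)%N then s (gcdn x n) * chi4 (x %/ gcdn x n)%N else 0.

Lemma order_over_divisor d : (d %| Q)%N -> (n %/ d = 4 * (Q %/ d))%N.
Proof. by move=> dQ; rewrite muln_divA. Qed.

(** If g = gcd(x, 4Q) divides [Q], multiplicativity of the character reduces the
    sum to the convolution at g.  Otherwise x has a larger power of 2 than
    [Q], so that all x/e are even. *)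
Lemma symbol_functionE s t x : chi_convolves Q s t ->
  symbol_function Q t x = signed_symbol s x.
Proof.
move=> st; rewrite /symbol_function /signed_symbol; set g := gcdn x n.
have gx : (g %| x)%N := dvdn_gcdl x n.
have eg (e : nat) : (e %| Q)%N -> (e %| x)%N -> (e %| g)%N.
  by move=> eQ ex; rewrite dvdn_gcd ex dvdn_mull.
case: ifP => gQ; last first.
  apply: big1 => -[/= e _] /andP[eQ ex]; rewrite chi4_even ?mulr0 //.
  apply: contraFN gQ => ox; have e0 := divisor_gt0 Q0 eQ.
  have -> : g = (e * gcdn (x %/ e) (4 * (Q %/ e)))%N.
    by rewrite muln_gcdr mulnC divnK // mulnCA (mulnC e) divnK.
  rewrite -{2}(divnK eQ) mulnC dvdn_pmul2r // Gauss_gcdr ?dvdn_gcdr //.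
  by change 4%N with (2 ^ 2)%N; rewrite coprimeXr // coprimen2.
rewrite st // mulr_suml; apply: eq_big => [e|e /andP[eQ ex]].
  apply/andP/idP => [[]|e_g]; first exact: eg.
  by rewrite (dvdn_trans e_g gQ) (dvdn_trans e_g gx).
have xe : (x %/ e = g %/ e * (x %/ g))%N.
  by rewrite mulnC muln_divA ?eg // divnK.
by rewrite xe chi4M mulrA.
Qed.

Lemma signed_symbol_opp s x : (0 < x < n)%N ->
  signed_symbol s (n - x)%N = - signed_symbol s x.
Proof.
move=> /andP[x0 xn]; rewrite /signed_symbol.
have -> : gcdn (n - x) n = gcdn x n.
  have sum_gcd a b : gcdn a (a + b) = gcdn b (a + b) by rewrite gcdnDl gcdnDr
    gcdnC.
  by have := sum_gcd (n - x)%N x; rewrite subnK // ltnW.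
set g := gcdn x n; case: ifP => gQ; last by rewrite oppr0.
have gx : (g %| x)%N := dvdn_gcdl x n.
rewrite -mulrN divnBl ?dvdn_gcdr // gx subn0 order_over_divisor //;
  congr (_ * _).
have : (x %/ g <= 4 * (Q %/ g))%N by rewrite -order_over_divisor // leq_div2r
  // ltnW.
rewrite /chi4; set a := (x %/ g)%N; set b := (Q %/ g)%N => le.
have -> : ((4 * b - a) %% 4 = (4 - a %% 4) %% 4)%N by lia.
have := ltn_pmod a (isT : (0 < 4)%N).
by case: (a %% 4)%N => [|[|[|[|?]]]].
Qed.

End SymbolFunction.

Section SymbolMembership.
Local Open Scope ring_scope.
Variables (n' : nat).
Local Notation n := n'.+2.
Hypothesis n4 : (4 %| n)%N.

Lemma val_intr_Zp (z : int) : (val (z%:~R : 'Z_n))%:Z = (z %% n)%Z.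
Proof.
rewrite {1}(divz_eq z n) intrD intrM -[n%:Z%:~R]/(n%:R) pchar_Zp // mulr0 add0r.
have : (0 <= z %% n)%Z by rewrite modz_ge0.
have := ltz_pmod z (isT : 0 < n%:Z); case: (z %% n)%Z => // c cn _.
rewrite -pmulrn; congr Posz.
by apply: etrans (val_Zp_nat (isT : (1 < n)%N) c) _; rewrite modn_small.
Qed.

(** Since 4d divides n, reducing dk modulo n changes neither the gcd with n nor
    the residue of k modulo 4. *)
Lemma mem_Gset (r d : nat) (x : 'Z_n) : (r < 4)%N -> (d %| n %/ 4)%N ->
  (x \in Gset n r d) = (gcdn x n == d) && ((x %/ d) %% 4 == r)%N.
Proof.
move=> r4 dQ; have Q0 : (0 < n %/ 4)%N by rewrite divn_gt0 // dvdn_leq.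
have d0 := divisor_gt0 Q0 dQ.
have nE : (n = d * (4 * (n %/ 4 %/ d)))%N.
  by rewrite mulnCA (mulnC d) divnK // mulnC divnK.
rewrite inE; apply/asboolP/andP => [[k [kr gk xk]]|[/eqP gx /eqP xr]].
  have xz : (val x)%:Z = (d%:Z * k %% n)%Z by rewrite xk val_intr_Zp.
  have gx : gcdn x n = d.
    have := gk; rewrite -gcdz_modl -xz; by case.
  split; first exact/eqP.
  have dx : (d %| x)%N by rewrite -gx dvdn_gcdl.
  pose y := (x %/ d)%N; pose b := (n %/ 4 %/ d)%N;
    pose c := ((d%:Z * k) %/ n)%Z.
  have xE : (val x)%:Z = d%:Z * y%:Z by rewrite -PoszM mulnC divnK.
  have E : d%:Z * k = c * (d%:Z * (4 * b%:Z)) + d%:Z * y%:Z.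
    by rewrite -xE xz -!PoszM -nE; exact: divz_eq.
  have {}E : k = c * (4 * b%:Z) + y%:Z.
    apply: (@mulfI _ d%:Z); first by rewrite eqz_nat -lt0n.
    by rewrite E; ring.
  by move: kr; rewrite -/y E; lia.
have dx : (d %| x)%N by rewrite -gx dvdn_gcdl.
have xE : (d * (x %/ d) = x)%N by rewrite mulnC divnK.
exists (x %/ d)%N; rewrite -PoszM xE; split.
- by rewrite -{}xr !modz_nat modn_mod.
- by congr Posz.
- by rewrite -pmulrn natr_Zp.
Qed.

End SymbolMembership.

Section SignPattern.
Local Open Scope ring_scope.

(** Presents the dependent pairs (D, sigma) as functions: [None] outside [D]. *)
Definition sign_pattern n (G : iocg_data n) :
    {ffun quarter_divisor n -> option bool} :=
  [ffun q => omap (tagged G) (insub q)].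

Definition signed_unit (b : option bool) : int :=
  if b is Some b' then if b' then 1 else -1 else 0.

Definition pattern_sign n (h : {ffun quarter_divisor n -> option bool}) (d :
  nat) : int :=
  oapp (fun q => signed_unit (h q)) 0 (insub d : option (seq_sub (divisors (n
    %/ 4)))).

Lemma pattern_sign_bound n (h : {ffun quarter_divisor n -> option bool}) d :
  -1 <= pattern_sign h d <= 1.
Proof.
by rewrite /pattern_sign; case: insubP => [q _ _|_] //=; case: (h q) => [[]|].
Qed.

Lemma pattern_sign_val n (h : {ffun quarter_divisor n -> option bool}) (q :
  quarter_divisor n) :
  pattern_sign h (val q) = signed_unit (h q).
Proof. by rewrite /pattern_sign valK. Qed.

Lemma sign_pattern_inj n : injective (@sign_pattern n).
Proof.
move=> [D sg] [D' sg'] E.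
have DD' : D = D'.
  apply/setP => q; have := congr1 (fun h : {ffun _ -> _} => isSome (h q)) E.
  rewrite !ffunE /=; do 2 case: insubP => [? -> _|/negPf->] //=.
subst D'; congr existT; apply/ffunP => d.
have := congr1 (fun h : {ffun _ -> _} => h (val d)) E.
by rewrite !ffunE /= valK /= => -[].
Qed.

Lemma sign_pattern_surj n (h : {ffun quarter_divisor n -> option bool}) :
  exists G : iocg_data n, sign_pattern G = h.
Proof.
pose D := [set q | isSome (h q)].
exists (existT _ D [ffun d => odflt true (h (val d))]).
apply/ffunP => q; rewrite ffunE /=; case: insubP => [d _ <-|] /=.
  by rewrite ffunE; have := valP d; rewrite inE; case: (h _).
by rewrite inE; case: (h q).
Qed.

Section Membership.
Variable n' : nat.
Local Notation n := n'.+2.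
Hypothesis n4 : (4 %| n)%N.
Local Notation Q := (n %/ 4)%N.

Lemma mul_quarter : (4 * Q = n)%N.
Proof. by rewrite mulnC divnK. Qed.

Lemma mem_symbol (G : iocg_data n) (x : 'Z_n) :
  (x \in iocg_symbol (tagged G)) =
  (signed_symbol Q (pattern_sign (sign_pattern G)) x == 1).
Proof.
have Q0 : (0 < Q)%N by rewrite divn_gt0 // dvdn_leq.
rewrite /signed_symbol mul_quarter; apply/bigcupP/idP => [[d _]|].
  set q := val d; have qQ : (val q %| Q)%N by rewrite dvdn_divisors // (valP q).
  have sE : pattern_sign (sign_pattern G) (val q) = signed_unit (Some (tagged G
    d)).
    by rewrite pattern_sign_val ffunE /= valK.
  rewrite /Sset; case: ifP => sg; rewrite -[_ \in Gset _ _ _]/(_ \in Gset n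
    (Posz _) _) mem_Gset //.
    by move=> /andP[/eqP-> /eqP x4]; rewrite qQ sE sg /chi4 x4.
  by move=> /andP[/eqP-> /eqP x4]; rewrite qQ sE sg /chi4 x4.
case: ifP => // gQ; set g := gcdn x n in gQ *.
have gD : g \in divisors Q by rewrite -dvdn_divisors.
pose q : quarter_divisor n := SeqSub gD.
rewrite -[g]/(val q) pattern_sign_val ffunE; case: insubP => [d dD dq|] //=.
  move=> H; exists d => //; rewrite /Sset dq; move: H; rewrite /chi4.
  case: (tagged G d) => /=; rewrite mem_Gset // eqxx /=.
    by case: (_ =P 1%N) => // _; case: (_ =P 3%N).
  by case: (_ =P 1%N) => // _; case: (_ =P 3%N).
by rewrite mul0r.
Qed.

(** The symbol and its opposite are disjoint because the signed symbol is odd,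
    so the two tests in the adjacency matrix read off its sign. *)
Lemma IOCG_adjacency (R : realType) (G : iocg_data n) t (u v : 'Z_n) :
  chi_convolves Q (pattern_sign (sign_pattern G)) t ->
  hermitian_adjacency R (IOCG (tagged G)) u v =
  'i%C * (symbol_function Q t (v - u)%R)%:~R.
Proof.
move=> st; have Q0 : (0 < Q)%N by rewrite divn_gt0 // dvdn_leq.
rewrite (symbol_functionE Q0 _ st) mxE /IOCG !mem_symbol -(opprB v u).
set s := pattern_sign _; set x := v - u.
have xopp : signed_symbol Q s (- x)%R = - signed_symbol Q s x.
  have [x0|x0] := eqVneq x 0.
    rewrite x0 oppr0 /signed_symbol gcd0n mul_quarter ifN ?oppr0 //.
    by rewrite gtnNdvd // ltn_Pdiv.
  rewrite -(signed_symbol_opp Q0); last by rewrite mul_quarter lt0n ltn_ord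
    (val_eqE x 0) x0.
  rewrite mul_quarter; congr signed_symbol.
  by rewrite /= modn_small // ltn_subrL lt0n (val_eqE x 0) x0.
rewrite xopp eqr_oppLR.
have : -1 <= signed_symbol Q s x <= 1.
  rewrite /signed_symbol; case: ifP => // _.
  have := pattern_sign_bound (sign_pattern G) (gcdn x (4 * Q)); rewrite -/s.
  by rewrite /chi4; case: eqP => _; last case: eqP => _; lia.
set f := signed_symbol _ _ _ => /andP[lo hi].
case: eqP => [->|n1]; first by rewrite mulr1.
case: eqP => [->|n2]; first by rewrite mulrN1z mulrN1.
have -> : f = 0 by lia.
by rewrite mulr0.
Qed.

End Membership.
End SignPattern.

(** * Counting the sign patterns *)
Section Counting.

(** Signs that allow multiple state transfer: forced to be present at [n %/ 4]
    and [n %/ 8], forced to be absent at the other divisors of the levels 0 and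
    1, free elsewhere. *)
Definition transfer_signs n (q : quarter_divisor n) : pred (option bool) :=
  fun b => if (val q == n %/ 4) || (val q == n %/ 4 %/ 2) then isSome b
           else (4 %| n %/ 4 %/ val q) || ~~ isSome b.

Lemma signed_unit_eq1N1 b : (signed_unit b == 1%R) || (signed_unit b == (-1)%R)
  = isSome b.
Proof. by case: b => [[]|]. Qed.

Lemma signed_unit_eq0 b : (signed_unit b == 0%R) = ~~ isSome b.
Proof. by case: b => [[]|]. Qed.

Lemma has_MST_transfer_signs (R : realType) n (G : iocg_data n) :
  0 < n -> 8 %| n ->
  has_MST R G <-> sign_pattern G \in family (@transfer_signs n).
Proof.
move=> n0 n8; case: n n0 n8 G => [|[|n']] // _ n8 G; set n := n'.+2 in n8 G *.
have n4 : 4 %| n := dvdn_trans (isT : 4 %| 8) n8.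
have NQ : n = 4 * (n %/ 4) by rewrite mul_quarter.
have Q0 : 0 < n %/ 4 by rewrite divn_gt0 // dvdn_leq.
have Q2 : 2 %| n %/ 4 by rewrite dvdn_divRL.
set Q := n %/ 4 in NQ Q0 Q2 *; set s := pattern_sign (sign_pattern G).
have [t st] := chi_convolves_exists Q0 s.
have s1 := pattern_sign_bound (sign_pattern G).
have QD : Q \in divisors Q by rewrite -dvdn_divisors.
have hD : Q %/ 2 \in divisors Q by rewrite -dvdn_divisors // dvdn_div.
have sq (q : quarter_divisor n) : s (val q) = signed_unit (sign_pattern G q).
  exact: pattern_sign_val.
apply: iff_trans (multiple_transfer_spectrum NQ st s1 (fun u v =>
  IOCG_adjacency n4 R u v st)) _.
split=> [[eps he HM]|/familyP fam].
  have [rs sQ sh] := rigid_of_spectrum Q0 Q2 st s1 he HM.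
  apply/familyP => q; rewrite unfold_in /transfer_signs -signed_unit_eq0
    -signed_unit_eq1N1 -sq.
  case: eqP => [->|/eqP qQ] /=; first by rewrite sQ.
  case: eqP => [->|/eqP qh] //=.
  case: (boolP (4 %| _)) => //= n4q; apply/eqP/rs => //.
  by rewrite dvdn_divisors // (valP q).
have famQ := fam (SeqSub QD : quarter_divisor n).
have famh := fam (SeqSub hD : quarter_divisor n).
rewrite !unfold_in /transfer_signs /= eqxx -signed_unit_eq1N1 -sq /= in famQ.
rewrite !unfold_in /transfer_signs /= eqxx orbT -signed_unit_eq1N1 -sq /= in
  famh.
exists (s Q) => //; apply: (spectrum_rigid Q0 Q2 st) => // d dQ n4d nQ nh.
have dD : d \in divisors Q by rewrite -dvdn_divisors.
have := fam (SeqSub dD : quarter_divisor n).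
rewrite unfold_in /transfer_signs /= (negPf nQ) (negPf nh) /= (negPf n4d) /=.
by rewrite -signed_unit_eq0 -sq => /eqP.
Qed.

(** A pattern in the family contains [n %/ 4], so nonemptiness is automatic. *)
Lemma card_sign_patterns (R : realType) n : 0 < n -> 8 %| n ->
  #|[set G : iocg_data n | (tag G != set0) && `[< has_MST R G >]]| =
  #|family (@transfer_signs n)|.
Proof.
move=> n0 n8; rewrite -(card_imset _ (@sign_pattern_inj n));
  apply: eq_card => h.
apply/imsetP/idP => [[G]|hF].
  by rewrite inE => /andP[_ /asboolP /has_MST_transfer_signs H] ->; apply: H.
have [G Gh] := sign_pattern_surj h; exists G => //; rewrite inE; apply/andP;
  split.
  have Q0 : 0 < n %/ 4 by rewrite divn_gt0 // dvdn_leq // (dvdn_trans _ n8).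
  have QD : n %/ 4 \in divisors (n %/ 4) by rewrite -dvdn_divisors.
  move/familyP/(_ (SeqSub QD : quarter_divisor n)): hF.
  rewrite unfold_in /transfer_signs /= eqxx -Gh ffunE /=.
  case: insubP => //= d dD _ _; apply/set0Pn; by exists (SeqSub QD).
by apply/asboolP/has_MST_transfer_signs => //; rewrite Gh.
Qed.

Lemma card_transfer_signs n (q : quarter_divisor n) :
  #|@transfer_signs n q| =
    if (val q == n %/ 4) || (val q == n %/ 4 %/ 2) then 2
    else if 4 %| n %/ 4 %/ val q then 3 else 1.
Proof.
rewrite /transfer_signs; case: ifP => _; last case: ifP => _ /=.
- transitivity #|predC1 (None : option bool)|; first by apply: eq_card => -[].
  by rewrite cardC1 card_option card_bool.
- transitivity #|{: option bool}|; first exact: eq_card.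
  by rewrite card_option card_bool.
- by rewrite (eq_card (_ : _ =i pred1 None)) ?card1 // => -[].
Qed.

Lemma prod_quarter_divisor n (c : nat -> nat) :
  \prod_(q : quarter_divisor n) c (val q) = \prod_(d <- divisors (n %/ 4)) c d.
Proof.
rewrite -(big_map val predT c); apply: perm_big; apply: uniq_perm.
- by rewrite map_inj_uniq ?index_enum_uniq //; exact: val_inj.
- exact: divisors_uniq.
move=> d; apply/mapP/idP => [[q _ ->]|dD]; first exact: valP.
by exists (SeqSub dD) => //; exact: mem_index_enum.
Qed.

End Counting.

Section LevelCount.
Variable Q : nat.
Hypothesis Q0 : 0 < Q.
Hypothesis Q2 : 2 %| Q.

(** Divisors of the levels 0 and 1 are the odd divisors and their doubles. *)
Lemma low_level_divisors L : (L \in divisors Q) && ~~ (4 %| L) =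
  (L \in divisors (2 * Q`_2^')).
Proof.
have m0 : 0 < Q`_2^' := part_gt0 _ _.
have om : odd Q`_2^' by rewrite odd_2'nat part_pnat.
have mQ : 2 * Q`_2^' %| Q.
  by rewrite Gauss_dvd ?coprime2n // Q2 dvdn_part.
rewrite -!dvdn_divisors ?muln_gt0 //; apply/andP/idP => [[LQ n4]|L2m].
  have L0 := dvdn_gt0 Q0 LQ.
  apply: dvdn_trans (level_bound Q0 LQ (erefl _)) _; apply: dvdn_mul => //.
  by rewrite (@dvdn_Pexp2l 2 _ 1) // leqNgt -logn2_dvd4.
split; first exact: dvdn_trans mQ.
apply/negP => /dvdn_trans /(_ L2m).
by rewrite (@dvdn_pmul2l 2 2) // dvdn2 om.
Qed.

Lemma tau_double m : odd m -> tau (2 * m) = 2 * tau m.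
Proof.
move=> om; have m0 : 0 < m by case: m om.
rewrite /tau [RHS]mul2n -addnn -[in X in _ + X](size_map (muln 2) (divisors m))
  -size_cat; apply: perm_size.
apply: uniq_perm; first exact: divisors_uniq.
  rewrite cat_uniq divisors_uniq map_inj_uniq ?divisors_uniq ?andbT; last first.
    by move=> x y /eqP; rewrite eqn_pmul2l // => /eqP.
  apply/hasPn => _ /mapP[L _ ->] /=; rewrite -dvdn_divisors //;
    apply/negP => Lm.
  by move: om; rewrite -[odd m]negbK -dvdn2 (dvdn_trans _ Lm) // dvdn_mulr.
move=> L; rewrite mem_cat -!dvdn_divisors ?muln_gt0 //.
apply/idP/orP => [L2m|[Lm|/mapP[K]]]; last 2 first.
- by rewrite dvdn_mull.
- by rewrite -dvdn_divisors // => Km ->; rewrite dvdn_pmul2l.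
have [/dvdnP[K LK]|n2] := boolP (2 %| L); [right|left].
  apply/mapP; exists K; last by rewrite LK mulnC.
  by rewrite -dvdn_divisors //; move: L2m; rewrite LK mulnC dvdn_pmul2l.
by move: L2m; rewrite Gauss_dvdr // coprime_sym coprime2n -[odd L]negbK -dvdn2.
Qed.

Lemma count_free_divisors :
  count (fun d => 4 %| Q %/ d) (divisors Q) = tau Q - 2 * tau Q`_2^'.
Proof.
rewrite -tau_double ?odd_2'nat ?part_pnat // /tau.
rewrite -(count_predC (fun d => 4 %| Q %/ d) (divisors Q)).
suff -> : count (predC (fun d => 4 %| Q %/ d)) (divisors Q) =
    size (divisors (2 * Q`_2^')) by rewrite addnK.
rewrite -size_filter -(size_map (divn Q) (divisors (2 * _))); apply: perm_size.
have in_low L : L \in divisors (2 * Q`_2^') -> L %| Q.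
  by rewrite -low_level_divisors -dvdn_divisors // => /andP[].
apply: uniq_perm; first by rewrite filter_uniq ?divisors_uniq.
  rewrite map_inj_in_uniq ?divisors_uniq // => L K /in_low LQ /in_low KQ.
  by move=> /(congr1 (divn Q)); rewrite !codivisorK.
move=> d; rewrite mem_filter /= -dvdn_divisors //.
apply/andP/mapP => [[n4 dQ]|[L Llow ->]].
  exists (Q %/ d); last by rewrite codivisorK.
  by rewrite -low_level_divisors n4 -dvdn_divisors // dvdn_div.
have LQ := in_low L Llow; rewrite codivisorK // dvdn_div //.
by move: Llow; rewrite -low_level_divisors => /andP[].
Qed.

Lemma prod_transfer_signs :
  \prod_(d <- divisors Q) (if (d == Q) || (d == Q %/ 2) then 2
                           else if 4 %| Q %/ d then 3 else 1) =
  2 * 2 * 3 ^ (tau Q - 2 * tau Q`_2^').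
Proof.
have ltQ : Q %/ 2 < Q by rewrite ltn_Pdiv.
have single a : a \in divisors Q ->
    \prod_(d <- divisors Q) (if d == a then 2 else 1) = 2.
  move=> aQ; rewrite (bigD1_seq a) ?divisors_uniq //= eqxx big1 // => d.
  by move/negPf->.
(* Q / Q = 1 and Q / (Q / 2) = 2 are not divisible by 4, so the conditions
   are exclusive and the factor splits. *)
have split_factor d : (if (d == Q) || (d == Q %/ 2) then 2
      else if 4 %| Q %/ d then 3 else 1) =
    (if d == Q then 2 else 1) * (if d == Q %/ 2 then 2 else 1) *
    (if 4 %| Q %/ d then 3 else 1).
  case: eqP => [->|_] /=; first by rewrite gtn_eqF // divnn Q0.
  by case: eqP => [->|_] /=; rewrite ?(codivisor_half Q0 Q2) ?mul1n.
under eq_bigr do rewrite split_factor.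
rewrite !big_split /= !single -?dvdn_divisors ?dvdn_div //; congr (_ * _).
by rewrite -big_mkcond big_const_seq iter_muln_1 count_free_divisors.
Qed.

End LevelCount.

Theorem corollary4p8 (R : realType) (n : nat) (n_gt0 : 0 < n) (n8 : 8 %| n) :
  #|[set G : iocg_data n | (tag G != set0) && `[< has_MST R G >]]|
  = 2 * 2 * 3 ^ (tau (n %/ 4) - 2 * tau (n %/ 2 ^ theta2 n)).
Proof.
have n4 : 4 %| n := dvdn_trans (isT : 4 %| 8) n8.
have Q0 : 0 < n %/ 4 by rewrite divn_gt0 // dvdn_leq.
have Q2 : 2 %| n %/ 4 by rewrite dvdn_divRL.
have -> : n %/ 2 ^ theta2 n = (n %/ 4)`_2^'.
  have -> : n %/ 2 ^ theta2 n = n`_2^'.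
    by rewrite -{1}(partnC 2 n_gt0) /theta2 -p_part mulKn ?part_gt0.
  by rewrite -{1}(divnK n4) partnM // mulnC part_p'nat ?mul1n ?pnatNK.
rewrite (card_sign_patterns R n_gt0 n8) card_family foldrE big_map big_enum /=.
rewrite -(prod_transfer_signs Q0 Q2) -prod_quarter_divisor.
by apply: eq_bigr => q _; exact: card_transfer_signs.
Qed.
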